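(* Let $\lambda$ be a cardinal, let $\mathcal F$ be an infinite family of sequentially compact spaces, let $X'$ be the disjoint union of all spaces in $\mathcal F$, and let $X=X'\cup\{\Omega\}$ be the sequential Aleksandroff compactification of $X'$. Suppose that $X$ is $\lambda$-ssc. Then the family $\mathcal F$ is $\lambda$-ssc.
   Context: $[\omega]^\omega$ is the set of all infinite subsets of $\omega$. A sequence $x=\langle x_n:n<\omega\rangle$ of points of a topological space converges along $H\in[\omega]^\omega$ if the subsequence $\langle x_n:n\in H\rangle$ converges. A topological space $X$ is $\lambda$-simultaneously sequentially compact ($\lambda$-ssc) if, whenever $\lambda$-many sequences with values in $X$ are given, there is $H\in[\omega]^\omega$ such that each of those sequences converges along $H$; sequentially compact means $1$-ssc, i.e. every sequence has a convergent subsequence. A family $\mathcal F$ of topological spaces is $\lambda$-ssc if, given $\lambda$-many sequences, each with values in one of the spaces in $\mathcal F$ (possibly different spaces for different sequences), there is $H\in[\omega]^\omega$ such that each of these sequences converges along $H$. The disjoint union of a family $\langle Y_\alpha:\alpha<\mu\rangle$ of (not necessarily distinct) spaces is the set $\bigcup_{\alpha<\mu}(\{\alpha\}\times Y_\alpha)$ with the topology generated by taking, for each $\alpha<\mu$, the topology on $\{\alpha\}\times Y_\alpha$ that makes it homeomorphic to $Y_\alpha$ via the bijection $\langle\alpha,y\rangle\mapsto y$. For a topological space $X'$, the sequential refinement $\mathrm{seq}(X')$ is the space with the same underlying set whose closed sets are precisely the sequentially closed subsets of $X'$ (those containing every limit of every convergent sequence of their points). If $X'$ is a topological space that is not sequentially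 compact and $\Omega\notin X'$, the sequential Aleksandroff compactification of $X'$ is $X=X'\cup\{\Omega\}$ with the topology whose open sets are the sets which are either equal to $A$ for some open $A\subseteq\mathrm{seq}(X')$, or equal to $X\setminus K$ for some sequentially compact $K\subseteq X'$. *)

(* Defs.v *)
From HB Require Import structures.
From mathcomp Require Import all_boot.
From mathcomp Require Import all_classical.
From mathcomp Require Import topology.

Set Implicit Arguments.
Unset Strict Implicit.
Unset Printing Implicit Defensive.

Local Open Scope classical_set_scope.

Section simultaneous_sequential_compactness.

(* The subsequence of x indexed by H converges to l when every neighbourhood
   of l contains x n for all large enough n in H. *)
Definition converges_along (T : topologicalType) (H : set nat) (x : nat -> T) :=
  exists l : T, x @ within H \oo --> l.

(* A cardinal is represented by a type L of that cardinality; a family of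
   sequences indexed by L may contain repetitions. *)
Definition ssc (L : Type) (T : topologicalType) :=
  forall x : L -> nat -> T,
    exists2 H : set nat, infinite_set H & forall l, converges_along H (x l).

Definition family_ssc (L : Type) (I : Type) (Y : I -> topologicalType) :=
  forall (a : L -> I) (x : forall l, nat -> Y (a l)),
    exists2 H : set nat, infinite_set H & forall l, converges_along H (x l).

Definition sequentially_compact (T : topologicalType) := ssc unit T.

(* Sequential compactness of K as a subspace: the limit is required in K. *)
Definition sequentially_compact_set (T : topologicalType) (K : set T) :=
  forall x : nat -> T, (forall n, K (x n)) ->
    exists2 H : set nat, infinite_set H &
      exists2 l : T, K l & x @ within H \oo --> l.

Definition sequentially_closed (T : topologicalType) (C : set T) :=
  forall (x : nat -> T) (l : T), (forall n, C (x n)) -> x @ \oo --> l -> C l.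

Lemma sequentially_compactT (T : topologicalType) :
  sequentially_compact T <-> sequentially_compact_set [set: T].
Proof.
split=> [cT x _|cT x].
  by have [H iH /(_ tt) [l xl]] := cT (fun=> x); exists H => //; exists l.
by have [//|H iH [l _ xl]] := cT (x tt); exists H => // -[]; exists l.
Qed.

Lemma infinite_set_above (H : set nat) (N : nat) :
  infinite_set H -> exists2 n, H n & (N <= n)%N.
Proof.
move=> iH; apply: contrapT => noH; apply: iH.
apply: (@sub_finite_set _ _ `I_N); last exact: finite_II.
move=> n Hn /=; rewrite ltnNge; apply/negP => Nn.
by apply: noH; exists n.
Qed.

Lemma infinite_setP (H : set nat) :
  infinite_set H <-> forall N, exists2 n, H n & (N <= n)%N.
Proof.
split=> [iH N|uH /finite_seqP[s HE]]; first exact: infinite_set_above.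
have [n Hn] := uH (\max_(i <- s) i)%N.+1.
by rewrite ltnNge leq_bigmax_seq//; move: Hn; rewrite HE.
Qed.

Lemma infinite_set_enum (H : set nat) : infinite_set H ->
  exists2 f : nat -> nat, (forall n, H (f n)) & (forall n, (n <= f n)%N).
Proof.
move=> iH; have /choice[f fP] N : exists n, H n /\ (N <= n)%N.
  by have [n ? ?] := infinite_set_above N iH; exists n.
by exists f => n; have [] := fP n.
Qed.

Lemma infinite_type_inj (I : Type) :
  infinite_set [set: I] -> exists f : nat -> I, injective f.
Proof.
elim/Ppointed: I => I.
  by rewrite emptyE => -[]; exact: finite_set0.
by move=> /infiniteP/pcard_leTP[f]; exists f => m n; apply: inj; rewrite inE.
Qed.

Lemma cvg_along_enum (T : topologicalType) (H : set nat) (x : nat -> T) (l : T)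
    (f : nat -> nat) : (forall n, H (f n)) -> (forall n, (n <= f n)%N) ->
  x @ within H \oo --> l -> (x \o f) @ \oo --> l.
Proof.
move=> fH fn xl U /xl [N _ NU]; exists N => // n /= Nn.
by apply: NU => //=; exact: leq_trans Nn (fn n).
Qed.

Lemma cvg_subseq (T : topologicalType) (x : nat -> T) (l : T)
    (f : nat -> nat) : (forall n, (n <= f n)%N) ->
  x @ \oo --> l -> (x \o f) @ \oo --> l.
Proof.
move=> fn xl U /xl[N _ NU]; exists N => // n /= Nn.
by apply: NU => /=; exact: leq_trans Nn (fn n).
Qed.

Lemma sequentially_compact_closed (T : topologicalType) (K : set T) :
  hausdorff_space T -> sequentially_compact_set K -> sequentially_closed K.
Proof.
move=> hT cK x l Kx xl; have [H iH [k Kk xk]] := cK x Kx.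
have [f fH fn] := infinite_set_enum iH.
have xfk := cvg_along_enum fH fn xk.
by rewrite (cvg_unique hT (cvg_subseq fn xl) xfk).
Qed.

Lemma sequentially_compact_setI (T : topologicalType) (K C : set T) :
  sequentially_compact_set K -> sequentially_closed C ->
  sequentially_compact_set (K `&` C).
Proof.
move=> cK cC x xKC.
have [|H iH [l Kl xl]] := cK x; first by move=> n; case: (xKC n).
exists H => //; exists l => //; split=> //.
have [f fH fn] := infinite_set_enum iH.
by apply: (cC (x \o f)); [move=> n; case: (xKC (f n))|exact: cvg_along_enum xl].
Qed.

Lemma sequentially_compact_setU (T : topologicalType) (K L : set T) :
  sequentially_compact_set K -> sequentially_compact_set L ->
  sequentially_compact_set (K `|` L).
Proof.
suff half (A : set T) (x : nat -> T) : sequentially_compact_set A ->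
    (forall N, exists2 n, A (x n) & (N <= n)%N) ->
    exists2 H : set nat, infinite_set H &
      exists2 l : T, A l & x @ within H \oo --> l.
  move=> cK cL x xKL.
  have [xK|xNK] := pselect (forall N, exists2 n, K (x n) & (N <= n)%N).
    by have [H iH [l Kl xl]] := half _ _ cK xK; exists H => //; exists l => //; left.
  have xL N : exists2 n, L (x n) & (N <= n)%N.
    apply: contrapT => nL; apply: xNK => M.
    case: (xKL (maxn M N)) => [Kx|Lx]; first by exists (maxn M N) => //; exact: leq_maxl.
    by case: nL; exists (maxn M N) => //; exact: leq_maxr.
  by have [H iH [l Ll xl]] := half _ _ cL xL; exists H => //; exists l => //; right.
move=> cA fA; have /choice[f fP] N : exists n, A (x n) /\ (N <= n)%N.
  by have [n ? ?] := fA N; exists n.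
have [H iH [l Al xl]] := cA (x \o f) (fun n => (fP n).1).
have fmax N : exists M, forall n, (n < N)%N -> (f n < M)%N.
  elim: N => [|N [M NM]]; first by exists 0%N.
  exists (maxn M (f N).+1) => n; rewrite ltnS leq_eqVlt => /orP[/eqP->|nN].
    exact: leq_maxr.
  by apply: leq_trans (leq_maxl _ _); exact: NM.
exists (f @` H).
  apply/infinite_setP => N; have [n Hn Nn] := infinite_set_above N iH.
  by exists (f n); [exists n|exact: leq_trans Nn (fP n).2].
exists l => // U /xl[N _ NU]; have [M NM] := fmax N.
exists M => // m /= Mm [n Hn fnm]; move: Mm; rewrite -fnm => Mfn.
apply: NU => //=; rewrite leqNgt; apply/negP => /NM.
by rewrite ltnNge Mfn.
Qed.

(* The disjoint union of infinitely many nonempty spaces is not sequentially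
   compact, so its sequential Aleksandroff compactification is defined. *)
Lemma sigT_not_sequentially_compact (I : choiceType) (Y : I -> topologicalType) :
  infinite_set [set: I] -> (forall i, [set: Y i] !=set0) ->
  ~ sequentially_compact {i & Y i}.
Proof.
move=> /infinite_type_inj[f finj] Y0 /(_ (fun=> fun n =>
  existT _ (f n) (projT1 (cid (Y0 (f n))))))[H iH /(_ tt)[[b y] yl]].
have /yl[N _ NU] : nbhs (existT _ b y) (existT Y b @` setT).
  by apply: existT_nbhs; exact: filterT.
have inU n : H n -> (N <= n)%N -> b = f n.
  move=> Hn Nn; have [/= z _ e] := NU n Nn Hn.
  exact: (f_equal (@projT1 _ _) e).
have [n Hn Nn] := infinite_set_above N iH.
have [m Hm nm] := infinite_set_above n.+1 iH.
have : n = m.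
  apply: finj.
  by rewrite -(inU n) // -(inU m) //; apply: leq_trans Nn _; apply: ltnW.
by move=> e; move: nm; rewrite e ltnn.
Qed.

End simultaneous_sequential_compactness.

Definition seq_refinement (T : topologicalType) : Type := T.

Section seq_refinement.
Context {T : topologicalType}.

Local Notation seqT := (seq_refinement T).

HB.instance Definition _ := Choice.on seqT.

Let seq_open : set_system seqT := fun A => @sequentially_closed T (~` A).

Let seq_openT : seq_open setT.
Proof. by move=> x l; rewrite setCT => /(_ 0%N). Qed.

Let seq_openI : setI_closed seq_open.
Proof.
move=> A B oA oB x l; rewrite setCI => xAB xl.
have [[N NB]|noN] := pselect (exists N, forall n, (N <= n)%N -> ~ B (x n)).
  right; apply: (oB (x \o addn N)); first by move=> n; apply: NB; exact: leq_addr.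
  by apply: cvg_subseq xl => n; exact: leq_addl.
have /choice[f fP] N : exists n, ~ A (x n) /\ (N <= n)%N.
  apply: contrapT => no; apply: noN; exists N => n Nn Bn.
  by case: (xAB n) => // An; apply: no; exists n.
left; apply: (oA (x \o f)); first by move=> n; have [] := fP n.
by apply: cvg_subseq xl => n; have [] := fP n.
Qed.

Let seq_open_bigU (J : Type) (f : J -> set seqT) :
  (forall j, seq_open (f j)) -> seq_open (\bigcup_j f j).
Proof.
move=> of_ x l xf xl [j _ fjl]; apply: (of_ j x l) => // n fjx.
by apply: (xf n); exists j.
Qed.

HB.instance Definition _ :=
  @isOpenTopological.Build seqT seq_open seq_openT seq_openI seq_open_bigU.

Lemma seq_refinement_closedE (C : set seqT) :
  closed C <-> @sequentially_closed T C.
Proof.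
by split=> [/closed_openC|cC]; [|rewrite -openC];
  rewrite /open/= /seq_open setCK.
Qed.

End seq_refinement.

Section seq_aleksandroff.
Context {T : topologicalType}.

Definition seq_aleksandroff (nsc : ~ sequentially_compact T) : Type := option T.

Context (nsc : ~ sequentially_compact T).

Local Notation X := (seq_aleksandroff nsc).

Definition seq_aleksandroff_open : set_system X := [set U : set X |
  (exists2 A : set (seq_refinement T), open A & U = Some @` (A : set T)) \/
  (exists2 K : set T, sequentially_compact_set K & U = ~` (Some @` K))].

HB.instance Definition _ := Choice.on X.
HB.instance Definition _ := Pointed.on X.

(* The topology is generated by seq_aleksandroff_open: without a separation
   property on T a sequentially compact set need not be sequentially closed, and
   then these sets need not be closed under intersection. When sequentially
   compact sets are sequentially closed, e.g. when T is Hausdorff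
   (sequentially_compact_closed), they are exactly the open sets, see
   seq_aleksandroff_openE. *)
HB.instance Definition _ := @isSubBaseTopological.Build X
  (set X) seq_aleksandroff_open id.

Lemma sub_seq_aleksandroff_open (U : set X) : seq_aleksandroff_open U -> open U.
Proof.
move=> oU; exists [set U]; last by rewrite bigcup_set1.
by move=> _ ->; exact: (@finI_from1 _ _ _ id).
Qed.

Lemma seq_aleksandroff_openE (U : set X) :
  (forall K : set T, sequentially_compact_set K -> sequentially_closed K) ->
  open U <-> seq_aleksandroff_open U.
Proof.
move=> cT; split; last exact: sub_seq_aleksandroff_open.
pose P (V : set X) := sequentially_closed (~` (Some @^-1` V) : set T) /\
  (V None -> sequentially_compact_set (~` (Some @^-1` V) : set T)).
have GP (V : set X) : seq_aleksandroff_open V -> P V.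
  move=> [[A oA ->]|[K cK ->]].
    have -> : P (Some @` A) = (sequentially_closed (~` A : set T) /\ True).
      rewrite /P (_ : Some @^-1` _ = A); last first.
        by apply/seteqP; split=> t; [move=> [? ? [<-]]|exists t].
      by congr (_ /\ _); apply/propext; split=> // _ [].
    by split=> //; apply/seq_refinement_closedE; exact: open_closedC.
  rewrite /P (_ : ~` (Some @^-1` _) = K); first by split=> //; exact: cT.
  apply/seteqP; split=> t /=; first by move=> /contrapT[s Ks [<-]].
  by move=> Kt; apply; exists t.
have PG (V : set X) : P V -> seq_aleksandroff_open V.
  move=> [cV KV]; have [VN|nV] := pselect (V None).
    right; exists (~` (Some @^-1` V)); [exact: KV|apply/seteqP; split=> [v Vv [t nVt tv]|]].
      by apply: nVt; rewrite /= tv.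
    move=> [t|] // nV.
    by apply: contrapT => nVt; apply: nV; exists t.
  left; exists (Some @^-1` V).
    by rewrite -closedC; apply/seq_refinement_closedE.
  by apply/seteqP; split=> [[t|] //|_ [t Vt <-]//]; exists t.
have PI (V W : set X) : P V -> P W -> P (V `&` W).
  move=> [cV KV] [cW KW]; split; rewrite preimage_setI setCI.
    by apply/seq_refinement_closedE; apply: closedU; apply/seq_refinement_closedE.
  by move=> [V0 W0]; apply: sequentially_compact_setU; [exact: KV|exact: KW].
have PT : P setT.
  by rewrite /P preimage_setT setCT; split=> [x l /(_ 0%N)|_ x /(_ 0%N)].
have PD (V : set X) : finI_from seq_aleksandroff_open id V -> P V.
  move=> [D DG <-]; rewrite bigcap_fset big_seq; apply: big_ind => //.
  by move=> i iD; apply: GP; have /set_mem := DG i iD.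
move=> [D DG <-]; apply: PG; rewrite /P preimage_bigcup.
have cU : sequentially_closed (~` (\bigcup_(V in D) Some @^-1` V) : set T).
  move=> x l xD xl [V DV Vl]; have [cV _] := PD _ (DG _ DV).
  by apply: (cV x l) => // n Vn; apply: (xD n); exists V.
split=> // -[V DV VN]; have [_ /(_ VN) KV] := PD _ (DG _ DV).
rewrite (_ : ~` _ = ~` (Some @^-1` V) `&` ~` (\bigcup_(V in D) Some @^-1` V)).
  exact: sequentially_compact_setI.
by apply/seteqP; split=> [t nt|t [_ nt]] //; split=> // Vt; apply: nt; exists V.
Qed.

End seq_aleksandroff.

(* Main.v *)
Require Import Defs.
From mathcomp Require Import all_boot all_classical topology.

(** A sequence that lives in one summand [Y i] is also a sequence in the
    compactification [X] of the disjoint union, so simultaneous convergence in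
    [X] gives one infinite [H] that works for all the given sequences, and it
    remains to see that convergence in [X] along [H] descends to [Y i]:

    - the limit is not the point at infinity, because the summand [Y i] is
      sequentially compact, and so its complement is a neighbourhood of that
      point which the sequence never meets ([not_cvg_along_infty]);
    - passing to the sequential refinement only adds open sets, so every open
      set of the disjoint union is open in [X], and a finite limit in [X] is a
      limit in the disjoint union ([cvg_along_finite]);
    - the summand [Y i] is clopen in the disjoint union and carries its own
      topology, so that limit is a point of [Y i], and the sequence converges to
      it in [Y i] ([cvg_along_summand]). *)

Set Implicit Arguments.
Unset Strict Implicit.
Unset Printing Implicit Defensive.

Local Open Scope classical_set_scope.

Lemma closed_sequentially_closed (T : topologicalType) (C : set T) :
  closed C -> sequentially_closed C.
Proof. by move=> cC x l xC xl; apply: (closed_cvg C) xl => //; exact: nearW. Qed.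

Lemma sequentially_compact_set_image (S T : topologicalType) (f : S -> T) :
  continuous f -> sequentially_compact S -> sequentially_compact_set (range f).
Proof.
move=> cf cS x xf; have /choice[y fy] n : exists s, f s = x n.
  by have [s _ <-] := xf n; exists s.
have [H iH /(_ tt)[l yl]] := cS (fun=> y).
exists H => //; exists (f l); first by exists l.
by rewrite -(_ : f \o y = x); [exact: cvg_comp yl (cf l)|exact/funext].
Qed.

(** Along a finite [H] every sequence converges to every point: infinity of [H]
    is what makes a neighbourhood of the limit meet the sequence. *)
Lemma cvg_along_meets (T : topologicalType) (H : set nat) (x : nat -> T) (l : T)
    (U : set T) :
  infinite_set H -> x @ within H \oo --> l -> nbhs l U -> exists n, U (x n).
Proof.
move=> iH xl /xl[N _ NU]; have [n Hn Nn] := infinite_set_above N iH.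
by exists n; exact: NU.
Qed.

Section compactification.
Context {T : topologicalType} (nsc : ~ sequentially_compact T).

Local Notation X := (seq_aleksandroff nsc).

Lemma open_finite_part (A : set T) : open A -> open (Some @` A : set X).
Proof.
move=> oA; apply: sub_seq_aleksandroff_open; left; exists A => //.
rewrite -closedC; apply/seq_refinement_closedE.
by apply: closed_sequentially_closed; exact: open_closedC.
Qed.

Lemma not_cvg_along_infty (K : set T) (H : set nat) (x : nat -> T) :
  sequentially_compact_set K -> infinite_set H -> (forall n, K (x n)) ->
  ~ (fun n => Some (x n) : X) @ within H \oo --> (None : X).
Proof.
move=> cK iH xK xl.
have oK : open (~` (Some @` K) : set X).
  by apply: sub_seq_aleksandroff_open; right; exists K.
have nK : nbhs (None : X) (~` (Some @` K)).
  by apply: open_nbhs_nbhs; split=> // -[].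
by have [n] := cvg_along_meets iH xl nK; apply; exists (x n).
Qed.

Lemma cvg_along_finite (H : set nat) (x : nat -> T) (l : T) :
  (fun n => Some (x n) : X) @ within H \oo --> (Some l : X) ->
  x @ within H \oo --> l.
Proof.
move=> xl U; rewrite nbhsE => -[A [oA Al] AU].
have /xl[N _ NA] : nbhs (Some l : X) (Some @` A).
  by apply: open_nbhs_nbhs; split; [exact: open_finite_part|exists l].
exists N => // n Nn Hn; have [t At [tx]] := NA n Nn Hn.
by apply: AU; rewrite -tx.
Qed.

End compactification.

Lemma cvg_along_summand (I : choiceType) (Y : I -> topologicalType) (i : I)
    (H : set nat) (x : nat -> Y i) (l : {i & Y i}) : infinite_set H ->
  (fun n => existT Y i (x n)) @ within H \oo --> l -> converges_along H x.
Proof.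
case: l => j y iH xl.
have nj U : nbhs y U -> nbhs (existT Y j y) (existT Y j @` U).
  exact: existT_nbhs.
have [n [z _ /(congr1 (@projT1 _ _))/= ji]] :=
  cvg_along_meets iH xl (nj _ filterT).
case: _ / ji x xl => x xl; exists y => U /nj/xl[N _ NU].
exists N => // m Nm Hm; have [u Uu ux] := NU m Nm Hm.
by rewrite /= -(existT_inj2 ux).
Qed.

Theorem theorem4p12 (L : Type) (I : choiceType) (Y : I -> topologicalType)
    (infI : infinite_set [set: I])
    (Yc : forall i, sequentially_compact (Y i))
    (nsc : ~ sequentially_compact {i : I & Y i}) :
  ssc L (seq_aleksandroff nsc) -> family_ssc L Y.
Proof.
move=> cX a x.
have [H iH xH] := cX (fun l n => Some (existT Y (a l) (x l n))).
exists H => // l; have [[p|] xl] := xH l.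
  exact: cvg_along_summand iH (cvg_along_finite xl).
have cY : sequentially_compact_set (range (existT Y (a l))).
  by apply: sequentially_compact_set_image; [exact: existT_continuous|].
by case: (not_cvg_along_infty (x := fun n => existT Y (a l) (x l n)) cY iH _ xl).
Qed.
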